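(* Let $\Gamma$ be a finite simplicial graph of girth at least $5$. Then there is a flag-no-square triangulation of an orientable closed surface containing $\Gamma$ as an induced subgraph (of its 1-skeleton).
   Context: A finite simplicial complex $L$ is flag if every collection of pairwise adjacent vertices of $L$ spans a simplex of $L$. It is flag-no-square if it is flag and has no induced 4-cycles. A subcomplex $L'\subset L$ is induced (or full) if whenever a simplex of $L$ has vertex set in $L'$, the simplex itself is in $L'$; an induced subgraph is one containing every edge of the ambient graph joining two of its vertices. Girth is the length of a shortest cycle (infinite for a forest). *)

(* Defs.v *)
From mathcomp Require Import all_boot all_order all_algebra.
From mathcomp Require Import all_classical all_reals all_analysis.

Set Implicit Arguments.
Unset Strict Implicit.
Unset Printing Implicit Defensive.

Import Order.TTheory GRing.Theory Num.Theory.
Import numFieldNormedType.Exports.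

Local Open Scope ring_scope.

Section Graphs.
Variable T : finType.

Definition simple_graph (e : rel T) : Prop := symmetric e /\ irreflexive e.

(* [ucycle e c] alone also accepts lists of length at most 2, such as [::]
   and, when [e] is symmetric, the two ends of an edge. *)
Definition graph_cycle (e : rel T) (c : seq T) : bool :=
  ucycleb e c && (2 < size c)%N.

(* This is [g <= girth e], where the girth of a forest is infinite. *)
Definition girth_at_least (e : rel T) (g : nat) : Prop :=
  forall c : seq T, graph_cycle e c -> (g <= size c)%N.

End Graphs.

Definition induced_embedding (T V : finType) (e : rel T) (h : rel V)
    (f : T -> V) : Prop :=
  injective f /\ forall x y : T, h (f x) (f y) = e x y.

(* Simplices are nonempty, and every element of [V] is a vertex. *)
Record scomplex (V : finType) := SComplex {
  simplices :> {set {set V}};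
  simplex_neq0 : finset.set0 \notin simplices;
  simplex_vertex : forall v : V, [set v]%SET \in simplices;
  simplex_face : forall s t : {set V},
    s \in simplices -> t \subset s -> t != finset.set0 -> t \in simplices }.

Section Complexes.
Variables (V : finType) (L : scomplex V).

Definition skel1 : rel V :=
  fun x y => (x != y) && ([set x; y]%SET \in simplices L).

Definition flag : Prop :=
  forall s : {set V}, s != finset.set0 ->
    {in s &, forall x y, x != y -> skel1 x y} -> s \in simplices L.

Definition induced_4cycle (a b c d : V) : bool :=
  [&& graph_cycle skel1 [:: a; b; c; d], ~~ skel1 a c & ~~ skel1 b d].

Definition flag_no_square : Prop :=
  flag /\ forall a b c d : V, ~~ induced_4cycle a b c d.

Definition triangle (a b c : V) : bool :=
  uniq [:: a; b; c] && ([set a; b; c]%SET \in simplices L).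

(* [o a b c] says that the ordering (a, b, c) of the triangle {a, b, c} is
   positive.  An orientation of a triangle is a class of orderings modulo even
   permutations, and two triangles on a common edge are coherently oriented
   when they induce opposite directions on that edge. *)
Definition coherent_orientation (o : V -> V -> V -> bool) : Prop :=
  [/\ forall a b c, triangle a b c -> o b c a = o a b c,
      forall a b c, triangle a b c -> o b a c = ~~ o a b c &
      forall a b c d, triangle a b c -> triangle a b d -> c != d ->
        o a b d = ~~ o a b c].

Definition orientable : Prop := exists o, coherent_orientation o.

Local Open Scope classical_set_scope.

(* Points are given by their barycentric coordinates. *)
Definition realization (R : realType) : set (prod_topology (fun _ : V => R)) :=
  [set x | [/\ forall v, 0 <= x v, \sum_v x v = 1 &
               [set v | x v != 0]%SET \in simplices L]].

End Complexes.

Arguments realization {V} L R _.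

Section Surfaces.
Local Open Scope classical_set_scope.

Definition homeomorphic (X Y : topologicalType) : Prop :=
  exists (f : X -> Y) (g : Y -> X),
    [/\ continuous f, continuous g, cancel f g & cancel g f].

Definition locally_euclidean (R : realType) (n : nat) (X : topologicalType) :
    Prop :=
  forall x : X, exists (U : set X) (W : set 'rV[R]_n),
    [/\ open_nbhs x U, open W & homeomorphic (set_type U) (set_type W)].

Definition manifold (R : realType) (n : nat) (X : topologicalType) : Prop :=
  [/\ hausdorff_space X, @second_countable X & locally_euclidean R n X].

(* In the library, [connected set0] holds. *)
Definition closed_surface (R : realType) (X : topologicalType) : Prop :=
  [/\ manifold R 2 X, compact [set: X], connected [set: X] & [set: X] !=set0].

End Surfaces.

(* The triangulated surface is the geometric realization itself, with its
   topology as a subspace of R^V. *)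
Definition closed_surface_triangulation (R : realType) (V : finType)
    (L : scomplex V) : Prop :=
  closed_surface R (set_type (realization L R)).

(* Main.v *)
From HB Require Import structures.
Require Import Defs.
From mathcomp Require Import all_boot all_order all_algebra.
From mathcomp Require Import all_classical all_reals all_analysis.
From mathcomp Require Import ring lra zify.

(** Enlarge the graph, keeping its girth at least 5, so that it becomes
    connected without vertices of degree less than 2, and choose a cyclic
    order of the neighbors of each vertex. The facial walks of this ribbon
    graph do not backtrack, so they have length at least 5. Fill each face,
    a polygon with sides d, by an annulus of triangles between the boundary
    and a ring of vertices u_d, a second annulus between the u_d and a ring
    of vertices w_d, and a cone over the w_d. A path of length 2 through the
    interior of a face joins the ends of a side, and one of length 3 joins
    vertices that are at most two sides apart on the facial walk. As the
    graph has no cycle of length 3 or 4, every 3-cycle of the 1-skeleton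
    bounds a triangle and every 4-cycle has a diagonal. The links of the
    vertices are cycles of length at least 4, and the open cone over such a
    cycle is homeomorphic to an open subset of the plane through the
    piecewise linear coordinates of a complete fan. *)

(** * Piecewise linear coordinates on the plane *)

Section Fan.
Local Set Implicit Arguments.
Local Unset Strict Implicit.
Import Order.TTheory GRing.Theory Num.Theory.
Import numFieldNormedType.Exports.
Local Open Scope ring_scope.
Local Open Scope classical_set_scope.
Variable R : realType.

(* Coordinates supported on two cyclically consecutive indices below [n]; for
   [n > 3] it is enough to ask this of pairs of indices. *)
Definition cyclic_cone (n : nat) (y : nat -> R) : Prop :=
  (forall i, 0 <= y i) /\
  (forall i j, (i.+1 < j < n)%N -> ~~ ((i == 0%N) && (j.+1 == n)) ->
     y i = 0 \/ y j = 0).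

(* The rays [p 0], ..., [p n.-1] cut the plane into sectors, and [t i z] is the
   coefficient of [p i] when [z] is written in the sector containing it. *)
Definition fan (n : nat) (p : nat -> 'rV[R]_2) (t : nat -> 'rV[R]_2 -> R) :=
  [/\ forall i, continuous (t i), forall z, cyclic_cone n (t^~ z),
      forall z, \sum_(i < n) t i z *: p i = z &
      forall y, cyclic_cone n y ->
        forall i, (i < n)%N -> t i (\sum_(j < n) y j *: p j) = y i].

(** The rays are the four coordinate half-axes, and the coefficients are the positive and negative
    parts of the two coordinates. *)
Lemma fan4 : exists p t, fan 4 p t.
Proof.
pose p i : 'rV[R]_2 := match i with 0%N => delta_mx 0 0 | 1%N => delta_mx 0 1
  | 2%N => - delta_mx 0 0 | _ => - delta_mx 0 1 end.
pose t i (z : 'rV[R]_2) : R := match i with 0%N => Num.max (z 0 0) 0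
  | 1%N => Num.max (z 0 1) 0 | 2%N => Num.max (- z 0 0) 0
  | 3%N => Num.max (- z 0 1) 0 | _ => 0 end.
have coordE (y : nat -> R) (z := \sum_(j < 4) y j *: p j) :
    z 0 0 = y 0%N - y 2%N /\ z 0 1 = y 1%N - y 3%N.
  rewrite /z !big_ord_recr big_ord0 /= /p !mxE /=.
  by split; ring.
have ccoord k : continuous (fun z : 'rV[R]_2 => z 0 k).
  exact: coord_continuous.
exists p, t; split.
- have cmax (f : 'rV[R]_2 -> R) : continuous f ->
      continuous (fun z => Num.max (f z) 0).
    move=> cf z.
    exact: (@continuous_max _ _ f (fun=> 0) z (cf z) (@cst_continuous _ _ _ _)).
  have cN k : continuous (fun z : 'rV[R]_2 => - z 0 k).
    by move=> z; exact: (cvgN (ccoord k z)).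
  case=> [|[|[|[|i]]]].
  - exact: (cmax _ (ccoord 0)).
  - exact: (cmax _ (ccoord 1)).
  - exact: (cmax _ (cN 0)).
  - exact: (cmax _ (cN 1)).
  - by exact: cst_continuous.
- move=> z; split.
    by rewrite /t; case=> [|[|[|[|i]]]] /=; rewrite ?le_max lexx ?orbT.
  have zero (a : R) : Num.max a 0 = 0 \/ Num.max (- a) 0 = 0.
    case: (lerP a 0) => ?; [by left|right].
    by case: (lerP (- a) 0) => ?; lra.
  move=> i j ij nij.
  (* Below 4, the only pairs that are not cyclically consecutive are (0, 2) and (1, 3). *)
  have /orP[/andP[/eqP-> /eqP->]|/andP[/eqP-> /eqP->]] :
    (i == 0%N) && (j == 2%N) || (i == 1%N) && (j == 3%N) by lia.
    exact: zero.
  exact: zero.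
- move=> z; apply/rowP => k.
  have [e0 e1] := coordE (t^~ z).
  have maxB (a : R) : Num.max a 0 - Num.max (- a) 0 = a.
    by case: (lerP 0 a) => ?; case: (lerP (- a) 0) => ?; lra.
  have /orP[/eqP->|/eqP->] : (k == 0) || (k == 1) by case: k => -[|[|]].
  + by rewrite e0 /= maxB.
  + by rewrite e1 /= maxB.
- move=> y [y0 yadj] i i4; have [e0 e1] := coordE y.
  have h02 : y 0%N = 0 \/ y 2%N = 0 by apply: yadj.
  have h13 : y 1%N = 0 \/ y 3%N = 0 by apply: yadj.
  have maxE (a b : R) : 0 <= a -> 0 <= b -> a = 0 \/ b = 0 ->
      Num.max (a - b) 0 = a.
    by move=> a0 b0 []->; case: (lerP (_ - _) 0) => ?; lra.
  have maxE' (a b : R) : 0 <= a -> 0 <= b -> a = 0 \/ b = 0 ->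
      Num.max (- (a - b)) 0 = b.
    by move=> a0 b0 []->; case: (lerP (- (_ - _)) 0) => ?; lra.
  by case: i i4 => [|[|[|[|i]]]] //= _; rewrite ?e0 ?e1 ?maxE ?maxE'.
Qed.

(* The sector spanned by the last and the first ray is cut along the sum of
   these rays. *)
Lemma fanS n p t : (3 < n)%N -> fan n p t -> exists p' t', fan n.+1 p' t'.
Proof.
move=> n3 [ct conet tK Kt].
have [m nE] : exists m, n = m.+2 by exists n.-2; lia.
subst n.
pose p' (i : nat) := if i == m.+2 then p 0%N + p m.+1 else p i.
(* In the sector that is cut, a [p 0] + b [p m.+1] has coefficient min(a, b) on the new ray, which
   is then subtracted from a and b. In every other sector this minimum is 0. *)
pose q z := Num.min (t 0%N z) (t m.+1 z).
pose t' (i : nat) z := if i == m.+2 then q z else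
  if (i == 0%N) || (i == m.+1) then t i z - q z else t i z.
(* The coefficients on the old rays once the new ray is expanded as [p 0] + [p m.+1]. *)
pose c (y : nat -> R) (i : nat) :=
  if (i == 0%N) || (i == m.+1) then y i + y m.+2 else y i.
have sumE (y : nat -> R) :
    \sum_(j < m.+3) y j *: p' j = \sum_(j < m.+2) c y j *: p j.
  rewrite big_ord_recr /= {2}/p' eqxx.
  rewrite big_ord_recl big_ord_recr [RHS]big_ord_recl [in RHS]big_ord_recr /=.
  have -> : \sum_(i < m) y (bump 0 (widen_ord (leqnSn m) i))
        *: p' (bump 0 (widen_ord (leqnSn m) i)) =
      \sum_(i < m) c y (bump 0 (widen_ord (leqnSn m) i))
        *: p (bump 0 (widen_ord (leqnSn m) i)).
    apply: eq_bigr => i _; rewrite /p' /c /= /bump /=.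
    by rewrite !ifF //; have := ltn_ord i; lia.
  rewrite /p' /c /bump /= !add1n !eqxx.
  rewrite (_ : (m.+1 == m.+2) = false); last lia.
  rewrite !scalerDl scalerDr -!addrA; congr (_ + _).
  rewrite [RHS]addrC -!addrA; congr (_ + _); congr (_ + _).
  by rewrite addrC.
exists p', t'; split.
- have cq : continuous q.
    move=> z.
    exact: (@continuous_min _ _ (t 0%N) (t m.+1) z (ct _ _) (ct _ _)).
  move=> i z; rewrite /t'; case: (i == m.+2); first exact: cq.
  case: ((i == 0%N) || (i == m.+1)); last exact: ct.
  exact: (cvgB (ct i z) (cq z)).
- move=> z; have [t0 tadj] := conet z.
  have q0 : 0 <= q z by rewrite le_min !t0.
  have ql : q z <= t 0%N z by rewrite ge_min lexx.
  have qr : q z <= t m.+1 z by rewrite ge_min lexx orbT.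
  split.
    move=> i; rewrite /t'; case: ifP => // _.
    by case: ifP => // /orP[]/eqP->; lra.
  move=> i j ij nij.
  have [jm|jm] := eqVneq j m.+2.
    have im : (0 < i < m.+1)%N by lia.
    (* As there are at least 4 old rays, [i] fails to be a neighbor of 0 or of [m.+1]. *)
    have H0 : t 0%N z = 0 \/ t m.+1 z = 0 \/ t i z = 0.
      have [i1|i1] := eqVneq i 1%N.
        have [] := tadj i m.+1; [lia|lia|tauto|tauto].
      have [] := tadj 0%N i; [lia|lia|tauto|tauto].
    have qz0 : q z = 0 \/ t i z = 0.
      case: H0 => [h|[h|h]]; [left|left|by right]; lra.
    by rewrite /t' jm eqxx !ifF; [tauto|lia|lia].
  have t'le k : (k < m.+2)%N -> t k z = 0 -> t' k z = 0.
    rewrite /t' => km h; rewrite ifF; last lia.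
    case: ifP => // /orP[]/eqP kE; subst k; lra.
  have [ij0|ij0] := boolP ((i == 0%N) && (j == m.+1)).
    move/andP: ij0 => [/eqP-> /eqP->]; rewrite /t' /= !eqxx ifF; last lia.
    rewrite ?orbT /q; case: (lerP (t 0%N z) (t m.+1 z)) => ?.
      by left; lra.
    by right; lra.
  have [] := tadj i j; [lia|lia| |] => h; [left|right]; apply: t'le => //; lia.
- move=> z; rewrite (sumE (t'^~ z)) -[RHS]tK; apply: eq_bigr => i _.
  congr (_ *: _).
  have im := ltn_ord i.
  rewrite /c /t' /= eqxx (_ : (nat_of_ord i == m.+2) = false); last lia.
  by case: ((i == 0%N :> nat) || (i == m.+1 :> nat)); rewrite ?subrK.
- move=> y [y0 yadj] i im; rewrite sumE.
  have cc : cyclic_cone m.+2 (c y).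
    split; first by move=> k; rewrite /c; case: ifP => // _; exact: addr_ge0.
    move=> k l kl nkl.
    have cE j : (j != 0)%N -> j != m.+1 -> c y j = y j.
      by move=> j0 j1; rewrite /c ifF //; lia.
    have cE' j : y j = 0 -> y m.+2 = 0 -> c y j = 0.
      by rewrite /c => -> ->; rewrite addr0 if_same.
    have [] := yadj k l; [lia|lia| |] => h.
    + have [k0|k0] := eqVneq k 0%N; last by left; rewrite cE //; lia.
      have [] := yadj l m.+2; [lia|lia|move=> h'|move=> h'].
        by right; rewrite cE //; lia.
      by left; exact: cE'.
    + have [l0|l0] := eqVneq l m.+1; last by right; rewrite cE //; lia.
      have [] := yadj k m.+2; [lia|lia|move=> h'|move=> h'].
        by left; rewrite cE //; lia.
      by right; exact: cE'.
  (* The indices 0 and [m.+1] are no longer consecutive, so one of the two sums under the minimum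
     reduces to [y m.+2]. *)
  have h01 : y 0%N = 0 \/ y m.+1 = 0 by apply: yadj; lia.
  have qE : q (\sum_(j < m.+2) c y j *: p j) = y m.+2.
    rewrite /q !Kt //; rewrite /c /= !eqxx ?orbT.
    by have := y0 0%N; have := y0 m.+1; case: (lerP (_ + _) _); lra.
  rewrite /t' qE; have [->//|nim] := eqVneq i m.+2.
  rewrite !Kt //; try lia.
  by rewrite /c; case: ((i == 0%N) || (i == m.+1)); rewrite ?addrK.
Qed.

Lemma fan_exists n : (3 < n)%N -> exists p t, fan n p t.
Proof.
elim: n => // n IH; rewrite ltnS leq_eqVlt => /orP[/eqP<-|n3].
  exact: fan4.
by have [p [t F]] := IH n3; apply: fanS F.
Qed.

End Fan.

(** * Subspaces and pointwise convergence *)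

Section SubtypeTopology.
Local Set Implicit Arguments.
Local Unset Strict Implicit.
Local Open Scope classical_set_scope.
Variables (X : topologicalType) (A : set X).

Definition to_set_type (x : X) (Ax : A x) : set_type A :=
  exist _ x (mem_set Ax).

Lemma set_val_continuous : continuous (@set_val X A).
Proof. exact: initial_continuous. Qed.

Lemma continuous_set_type (Y : topologicalType) (f : Y -> set_type A) :
  continuous (fun y => set_val (f y)) -> continuous f.
Proof. exact: (@continuous_comp_initial _ _ _ (@set_val X A) f). Qed.

Lemma set_type_hausdorff : hausdorff_space X -> hausdorff_space (set_type A).
Proof.
move=> hX p q pq; apply: val_inj; apply: hX => U W Up Wq.
have [r [Ur Wr]] := pq _ _ (@set_val_continuous p U Up)
  (@set_val_continuous q W Wq).
by exists (set_val r).
Qed.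

Lemma set_type_compact : compact A -> compact [set: set_type A].
Proof.
move=> cA F PF FT.
have FA : nbhs (@set_val X A @ F) A.
  by apply: (@filterS _ F _ setT) => // -[x xA] _; exact: (set_mem xA).
have [p [Ap Fp]] := cA (nbhs (@set_val X A @ F)) _ FA.
exists (to_set_type Ap); split => //.
move=> U W FU; rewrite nbhsE => -[W' [[C oC <-] Cp] CW].
have [r [[u Uu <-] Cr]] : (@set_val X A @` U) `&` C !=set0.
  apply: (Fp _ C); last exact: open_nbhs_nbhs.
  by apply: (@filterS _ F _ U) => // x Ux; exists x.
by exists u; split => //; apply: CW.
Qed.

End SubtypeTopology.

Section CompactSecondCountable.
Local Open Scope classical_set_scope.
Variables (R : realType) (T : pseudoMetricType R).

Lemma compact_pseudometric_second_countable (a : T) :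
  compact [set: T] -> @second_countable T.
Proof.
pose PT : pseudoPMetricType R := HB.pack T (isPointed.Build T a).
by move=> cT; exact: (@compact_second_countable R PT cT).
Qed.

End CompactSecondCountable.

Lemma compact_subset_second_countable (R : realType) (T : pseudoMetricType R)
    (A : set T) :
  compact A -> (A !=set0)%classic -> @second_countable (set_type A).
Proof.
move=> cA [a Aa].
apply: (@compact_pseudometric_second_countable R (set_type A)).
  exact: to_set_type Aa.
exact: set_type_compact cA.
Qed.

Section Pointwise.
Local Set Implicit Arguments.
Local Unset Strict Implicit.
Import Order.TTheory GRing.Theory Num.Theory.
Import numFieldNormedType.Exports.
Local Open Scope classical_set_scope.
Variables (R : realType) (V : finType).
Let RV := prod_topology (fun _ : V => R).

Lemma coordinate_continuous (v : V) : continuous (fun x : RV => x v).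
Proof. exact: (@proj_continuous V (fun=> R) v). Qed.

Lemma continuous_pointwise (Y : topologicalType) (f : Y -> RV) :
  (forall v, continuous (fun y => f y v)) -> continuous f.
Proof.
move=> cf y; apply/cvg_sup => v.
exact: (@continuous_comp_initial _ _ _ (fun x : RV => x v) f (cf v) y).
Qed.

End Pointwise.

(** * Clique complexes and their realizations *)

Section CliqueComplex.
Local Set Implicit Arguments.
Local Unset Strict Implicit.
Local Open Scope set_scope.
Variables (V : finType) (h : rel V).

Definition cliques : {set {set V}} :=
  [set s : {set V} | (s != finset.set0) &&
    [forall x in s, forall y in s, (x != y) ==> h x y]].

Lemma cliquesP (s : {set V}) :
  reflect (s != finset.set0 /\ {in s &, forall x y, x != y -> h x y})
    (s \in cliques).
Proof.
rewrite inE; apply: (iffP andP) => -[s0 hs]; split=> //.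
  move=> x y xs ys xy.
  by have /forall_inP/(_ x xs)/forall_inP/(_ y ys)/implyP := hs; apply.
apply/forall_inP => x xs; apply/forall_inP => y ys; apply/implyP => xy.
exact: hs.
Qed.

Fact clique_complex_neq0 : finset.set0 \notin cliques.
Proof. by apply/cliquesP => -[/eqP]. Qed.

Fact clique_complex_vertex (v : V) : [set v] \in cliques.
Proof.
apply/cliquesP; split; first by apply/set0Pn; exists v; rewrite inE.
by move=> x y /set1P-> /set1P->; rewrite eqxx.
Qed.

Fact clique_complex_face (s t : {set V}) :
  s \in cliques -> t \subset s -> t != finset.set0 -> t \in cliques.
Proof.
move=> /cliquesP[_ hs] /fintype.subsetP ts t0.
apply/cliquesP; split=> // x y xt yt.
exact: hs (ts _ xt) (ts _ yt).
Qed.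

Definition clique_complex : scomplex V :=
  SComplex clique_complex_neq0 clique_complex_vertex clique_complex_face.

Hypotheses (h_sym : symmetric h) (h_irr : irreflexive h).

Lemma skel1_clique_complex : skel1 clique_complex =2 h.
Proof.
move=> x y; rewrite /skel1; have [->|xy] /= := eqVneq x y.
  by rewrite h_irr.
apply/cliquesP/idP => [[_ ]|hxy]; first by apply=> //; rewrite !inE eqxx ?orbT.
split; first by apply/set0Pn; exists x; rewrite !inE eqxx.
by move=> a b /set2P[]-> /set2P[]->; rewrite ?eqxx // h_sym.
Qed.

Lemma clique_complex_flag : flag clique_complex.
Proof.
move=> s s0 hs; apply/cliquesP; split=> // x y xs ys xy.
by rewrite -skel1_clique_complex; exact: hs.
Qed.

Lemma clique_complex_triangle a b c :
  triangle clique_complex a b c -> [/\ h a b, h b c & h a c].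
Proof.
move=> /andP[unq /cliquesP[_ hs]]; move: unq; rewrite /= !inE negb_or !andbT.
move=> /andP[/andP[ab ac] bc].
by split; apply: hs; rewrite // !inE eqxx ?orbT.
Qed.

Lemma clique_complex_flag_no_square :
  (forall a b c d, a != c -> b != d -> h a b -> h b c -> h c d -> h d a ->
     h a c || h b d) ->
  flag_no_square clique_complex.
Proof.
move=> hsq; split; first exact: clique_complex_flag.
move=> a b c d; apply/negP; rewrite /induced_4cycle /graph_cycle /ucycleb.
rewrite !skel1_clique_complex => /and3P[/andP[/andP[cyc unq] _] ac bd].
move: cyc; rewrite /= !skel1_clique_complex andbT => /and4P[hab hbc hcd hda].
have [aNc bNd] : a != c /\ b != d.
  move: unq; rewrite /= !inE !negb_or => /andP[/and3P[_ -> _]].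
  by move=> /andP[/andP[_ ->]].
by have := hsq a b c d aNc bNd hab hbc hcd hda; rewrite (negbTE ac) (negbTE bd).
Qed.

End CliqueComplex.

(** * Compactness of the realization *)

Section Realization.
Local Set Implicit Arguments.
Local Unset Strict Implicit.
Import Order.TTheory GRing.Theory Num.Theory.
Import numFieldNormedType.Exports.
Local Open Scope ring_scope.
Local Open Scope classical_set_scope.
Variables (R : realType) (V : finType) (h : rel V).
Hypothesis h_sym : symmetric h.

Let RV := prod_topology (fun _ : V => R).
Let K : set RV := realization (clique_complex h) R.
Let X := set_type K.

(** The support is nonempty because the coordinates have sum 1, so only the pairwise adjacency of
    its vertices has to be recorded. *)
Lemma realization_cliqueP (x : RV) :
  K x <-> [/\ forall v, 0 <= x v, \sum_v x v = 1 &
              forall a b, a != b -> x a != 0 -> x b != 0 -> h a b].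
Proof.
split=> -[x0 x1 xh]; split=> //.
  move=> a b ab xa xb; move/cliquesP: xh => [_]; apply=> //; by rewrite inE.
apply/cliquesP; split=> [|a b]; last by rewrite !inE => xa xb ab; exact: xh.
apply/negP => /eqP s0; have : \sum_v x v = 0.
  apply: big1 => v _; apply/eqP; apply/negPn/negP => xv.
  by have := finset.in_set0 v; rewrite -s0 inE xv.
by rewrite x1 => /eqP; rewrite oner_eq0.
Qed.

Lemma continuous_sum (W : normedModType R) (Y : topologicalType) (I : Type)
    (r : seq I) (A : pred I) (f : I -> Y -> W) :
  (forall i, A i -> continuous (f i)) ->
  continuous (fun y => \sum_(i <- r | A i) f i y).
Proof.
move=> cf; apply: continuous_big => //.
exact: add_continuous.
Qed.

Lemma sum_coordinates_continuous (A : pred V) :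
  continuous (fun x : RV => \sum_(v | A v) x v).
Proof.
apply: continuous_sum => v _; exact: coordinate_continuous.
Qed.

(** Adjacency on the support amounts to the closed conditions x a * x b = 0, one for each pair of
    distinct vertices that are not adjacent. *)
Lemma realization_closed : closed K.
Proof.
have -> : K = (\bigcap_(v in [set: V]) [set x : RV | 0 <= x v]) `&`
    [set x : RV | \sum_v x v = 1] `&`
    \bigcap_(p in [set p : V * V | p.1 != p.2 /\ ~~ h p.1 p.2])
      [set x : RV | x p.1 * x p.2 = 0].
  apply/seteqP; split=> x.
    move=> /realization_cliqueP[x0 x1 xh]; split.
      by split=> // v _; exact: x0.
    move=> -[a b] /= [ab hab]; apply/eqP; rewrite mulf_eq0.
    by apply: contraNT hab; rewrite negb_or => /andP[xa xb]; exact: xh.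
  move=> [[x0 x1] xh]; apply/realization_cliqueP; split=> //.
    by move=> v; exact: x0.
  move=> a b ab xa xb; apply/negPn/negP => hab.
  have /eqP := xh (a, b) (conj ab hab).
  by rewrite /= mulf_eq0 (negbTE xa) (negbTE xb).
apply: closedI; first apply: closedI.
- apply: closed_bigI => v _.
  apply: (@preimage_closed _ _ (fun x : RV => x v) [set r | 0 <= r]).
    by move=> x _; exact: coordinate_continuous.
  exact: closed_ge.
- apply: (@preimage_closed _ _ (fun x : RV => \sum_v x v) [set r | r = 1]).
    by move=> x _; exact: sum_coordinates_continuous.
  exact: closed_eq.
- apply: closed_bigI => p _.
  apply: (@preimage_closed _ _ (fun x : RV => x p.1 * x p.2) [set r | r = 0]).
    move=> x _.
    exact: (cvgM (@coordinate_continuous R V p.1 x)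
                 (@coordinate_continuous R V p.2 x)).
  exact: closed_eq.
Qed.

Lemma realization_le1 x v : K x -> x v <= 1.
Proof.
move=> /realization_cliqueP[x0 <- _]; rewrite (bigD1 v) //= lerDl.
exact: sumr_ge0.
Qed.

(** The realization is closed in the cube of all functions from [V] to [0, 1], which is compact by
    Tychonoff. *)
Lemma realization_compact : compact K.
Proof.
have cB := @tychonoff V (fun=> R) (fun=> `[0, 1]%classic)
  (fun=> @segment_compact R 0 1).
apply: subclosed_compact realization_closed cB _ => x Kx v /=.
have [x0 _ _] := (realization_cliqueP x).1 Kx.
by rewrite in_itv /= x0 realization_le1.
Qed.

Lemma realization_support x : K x -> exists v, x v != 0.
Proof.
move=> /realization_cliqueP[_ xS _].
apply/existsP; rewrite -negb_forall; apply/negP => /forallP x0.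
have : \sum_v x v = 0 by apply: big1 => v _; apply/eqP; exact: x0.
by rewrite xS => /eqP; rewrite oner_eq0.
Qed.

End Realization.

(** * Connectedness of the realization *)

Section Connectedness.
Local Set Implicit Arguments.
Local Unset Strict Implicit.
Import Order.TTheory GRing.Theory Num.Theory.
Import numFieldNormedType.Exports.
Local Open Scope ring_scope.
Local Open Scope classical_set_scope.
Variables (R : realType) (V : finType) (h : rel V).
Hypothesis h_sym : symmetric h.

Let RV := prod_topology (fun _ : V => R).
Let K : set RV := realization (clique_complex h) R.
Let X := set_type K.

Definition vertex_point (v : V) : RV := fun u => (u == v)%:R.

Lemma vertex_point_in v : K (vertex_point v).
Proof.
apply/realization_cliqueP; rewrite /vertex_point; split.
- by move=> u; exact: ler0n.
- rewrite (bigD1 v) //= eqxx big1 ?addr0 // => u uv; by rewrite (negbTE uv).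
- move=> a b; rewrite !pnatr_eq0 !eqb0 !negbK => /negP ab /eqP av /eqP bv.
  by case: ab; rewrite av bv.
Qed.

(** Clamping the parameter makes the segment between two points a path defined on all of [R] that
    never leaves the realization. *)
Let unit_clamp (t : R) : R := Num.max 0 (Num.min 1 t).

Lemma unit_clamp_continuous : continuous unit_clamp.
Proof.
have cmin : continuous (fun t : R => Num.min 1 t).
  by move=> t; exact: (@continuous_min _ _ (fun=> 1) id t
    (@cst_continuous _ _ _ _) (fun _ => id)).
move=> t; exact: (@continuous_max _ _ (fun=> 0) (fun t : R => Num.min 1 t) t
  (@cst_continuous _ _ _ _) (cmin t)).
Qed.

(** The hypothesis says that the supports of [x] and [y] lie in a common simplex, which then
    contains the straight segment between them. *)
Lemma segment_connected_component (x y : X) :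
  (forall a b, a != b -> \val x a != 0 \/ \val y a != 0 ->
     \val x b != 0 \/ \val y b != 0 -> h a b) ->
  connected_component [set: X] x y.
Proof.
move=> hxy.
have [x0 x1 xh] := (realization_cliqueP _ _).1 (set_valP x).
have [y0 y1 yh] := (realization_cliqueP _ _).1 (set_valP y).
pose f0 (t : R) : RV :=
  fun v => (1 - unit_clamp t) * \val x v + unit_clamp t * \val y v.
have clamp01 t : 0 <= unit_clamp t <= 1.
  rewrite /unit_clamp; case: (lerP 0 (Num.min 1 t)); rewrite ?lexx ?ler01 //.
  by move=> ->; rewrite ge_min lexx.
have Kf t : K (f0 t).
  have /andP[c0 c1] := clamp01 t.
  apply/realization_cliqueP; split.
  - by move=> v; rewrite addr_ge0 // mulr_ge0 // subr_ge0.
  - by rewrite big_split /= -!mulr_sumr x1 y1 !mulr1 subrK.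
  - have f0_neq0 v : f0 t v != 0 -> \val x v != 0 \/ \val y v != 0.
      have [xv|] := eqVneq (\val x v) 0; last by left.
      have [yv|] := eqVneq (\val y v) 0; last by right.
      by rewrite /f0 xv yv !mulr0 addr0 eqxx.
    by move=> a b ab /f0_neq0 xa /f0_neq0 xb; exact: hxy.
pose f t : X := to_set_type (Kf t).
have cf : continuous f.
  apply: continuous_set_type; apply: continuous_pointwise => v t /=.
  apply: cvgD; apply: cvgM; try exact: cvg_cst.
    by apply: cvgB; [exact: cvg_cst|exact: unit_clamp_continuous].
  exact: unit_clamp_continuous.
have fx : f 0 = x.
  apply: val_inj; apply/funext => v /=; rewrite /f0 /unit_clamp.
  rewrite (_ : Num.max 0 _ = 0); first by rewrite subr0 mul1r mul0r addr0.
  by rewrite min_r ?ler01 // maxxx.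
have fy : f 1 = y.
  apply: val_inj; apply/funext => v /=; rewrite /f0 /unit_clamp.
  rewrite (_ : Num.max 0 _ = 1); first by rewrite subrr mul1r mul0r add0r.
  by rewrite minxx max_r ?ler01.
exists (f @` `[0, 1]); last first.
  by exists 1 => //=; rewrite in_itv /= ler01 lexx.
split=> //; first by exists 0 => //=; rewrite in_itv /= ler01 lexx.
apply: connected_continuous_connected; first exact: segment_connected.
exact: continuous_subspaceT.
Qed.

Lemma realization_connected : (forall a b, connect h a b) ->
  connected [set: X].
Proof.
move=> h_conn.
have [[x1 _]|X0] := pselect ([set: X] !=set0); last first.
  rewrite (_ : [set: X] = set0); first exact: connected0.
  by apply/seteqP; split=> // x _; apply: X0; exists x.
pose pt v : X := to_set_type (vertex_point_in v).
have vE v u : \val (pt v) u != 0 -> u = v.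
  rewrite /= /vertex_point pnatr_eq0 eqb0 negbK => /eqP //.
have edge v w : h v w -> connected_component [set: X] (pt v) (pt w).
  move=> hvw; apply: segment_connected_component => a b ab.
  move=> [] /vE aE [] /vE bE; move: ab; rewrite aE bE ?eqxx // => _ //.
  by rewrite h_sym.
have conn v w : connected_component [set: X] (pt v) (pt w).
  have /connectP[p hp ->] := h_conn v w.
  elim: p v hp => [|u p IH] v /=.
    by move=> _; exact: connected_component_refl.
  by move=> /andP[/edge vu /IH]; exact: connected_component_trans.
(* A point shares a simplex with each vertex of its support. *)
have star (x : X) : exists v, connected_component [set: X] (pt v) x.
  have [x0 xS xh] := (realization_cliqueP _ _).1 (set_valP x).
  have [v xv] := realization_support (set_valP x).
  exists v; apply: segment_connected_component => a b ab xa xb.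
  apply: xh => //.
    by case: xa => // /vE ->.
  by case: xb => // /vE ->.
have [v1 v1x1] := star x1.
rewrite (_ : [set: X] = connected_component [set: X] (pt v1)).
  exact: component_connected.
apply/seteqP; split=> // x _; have [v vx] := star x.
exact: connected_component_trans (conn v1 v) vx.
Qed.

End Connectedness.

(** * Charts on the open stars of the vertices *)

Section Charts.
Local Set Implicit Arguments.
Local Unset Strict Implicit.
Import Order.TTheory GRing.Theory Num.Theory.
Import numFieldNormedType.Exports.
Local Open Scope ring_scope.
Local Open Scope classical_set_scope.
Variables (R : realType) (V : finType) (h : rel V).
Hypothesis h_sym : symmetric h.

Let RV := prod_topology (fun _ : V => R).
Let K : set RV := realization (clique_complex h) R.
Let X := set_type K.

(** The link of [v] is a cycle without chords, listed in cyclic order. Length 3 is ruled out since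
    [v] and three pairwise adjacent neighbors would span a tetrahedron of the clique complex. *)
Definition link_cycle (v : V) (l : seq V) : Prop :=
  [/\ uniq (v :: l), (3 < size l)%N, forall u, (u \in l) = h v u &
      forall i j, (i < j < size l)%N ->
        h (nth v l i) (nth v l j) =
          (j == i.+1) || (i == 0%N) && (j.+1 == size l)].

Section Star.
Variables (v : V) (l : seq V).
Hypothesis lk : link_cycle v l.
Let n := size l.

Lemma sum_star (y : V -> R) : (forall u, u != v -> u \notin l -> y u = 0) ->
  \sum_u y u = y v + \sum_(i < n) y (nth v l i).
Proof.
have [/= /andP[vl ul] _ _ _] := lk.
move=> y0; rewrite (bigD1 v) //=; congr (_ + _).
rewrite -(big_mkord xpredT (fun i => y (nth v l i))) -(big_nth v xpredT y).
rewrite [RHS]big_uniq //= [RHS]big_mkcond [LHS]big_mkcond /=.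
apply: eq_bigr => u _; case: eqVneq => [->|uv] /=; first by rewrite (negbTE vl).
by case: ifPn => // /(y0 u uv).
Qed.

(** Two link vertices in the support of a point are adjacent, and as the cycle has no chord they are
    consecutive. *)
Lemma star_cyclic_cone (y : RV) : K y ->
  cyclic_cone n (fun i => y (nth v l i)).
Proof.
have [/= /andP[vl ul] _ _ hl] := lk.
move=> /realization_cliqueP[y0 _ yh]; split; first by move=> i; exact: y0.
move=> i j ij nij.
case: (eqVneq (y (nth v l i)) 0) => [->|yi]; first by left.
case: (eqVneq (y (nth v l j)) 0) => [->|yj]; first by right.
have /andP[ij1 jn] := ij.
have ij' : (i < j < size l)%N by rewrite jn (ltnW ij1).
have ne : nth v l i != nth v l j by rewrite nth_uniq // -/n; lia.
have := yh _ _ ne yi yj; rewrite hl // (negbTE nij) orbF => /eqP jE.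
by rewrite jE ltnn in ij1.
Qed.

Variables (p : nat -> 'rV[R]_2) (t : nat -> 'rV[R]_2 -> R).
Hypothesis pt : fan n p t.

Definition open_star : set X := [set y | 0 < \val y v].

(** For a fan, this is the open disk bounded by the closed polygon through the points [p i]. *)
Definition star_image : set 'rV[R]_2 := [set z | \sum_(i < n) t i z < 1].

Lemma open_star_open : open open_star.
Proof.
have cv : continuous (fun y : X => \val y v).
  move=> y; exact: (continuous_comp (@set_val_continuous _ K y)
    (@coordinate_continuous R V v (\val y))).
apply: (@open_comp _ _ (fun y : X => \val y v) [set r | 0 < r]).
  by move=> y _; exact: cv.
exact: open_gt.
Qed.

Lemma tent_sum_continuous : continuous (fun z => \sum_(i < n) t i z).
Proof. by have [ct _ _ _] := pt; apply: continuous_sum => i _; exact: ct. Qed.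

Lemma star_image_open : open star_image.
Proof.
apply: (@open_comp _ _ (fun z => \sum_(i < n) t i z) [set r | r < 1]).
  by move=> z _; exact: tent_sum_continuous.
exact: open_lt.
Qed.

(** The vertex [v] goes to the origin and its neighbors to the points [p i]. The coordinate at [v]
    is not recorded, as it is 1 minus the others. *)
Definition star_chart (y : RV) : 'rV[R]_2 := \sum_(i < n) y (nth v l i) *: p i.

Lemma tent_star_chart (y : RV) i : K y -> (i < n)%N ->
  t i (star_chart y) = y (nth v l i).
Proof.
move=> Ky ni; have [_ _ _ Kt] := pt.
exact: (Kt (fun i => y (nth v l i)) (star_cyclic_cone Ky) i ni).
Qed.

Lemma star_chart_continuous : continuous star_chart.
Proof.
apply: (@continuous_sum R 'rV[R]_2 RV 'I_n (index_enum _) xpredT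
  (fun i y => y (nth v l i) *: p i)) => i _ y.
exact: (@cvgZr_tmp R 'rV[R]_2 RV (nbhs y) _ (fun y => y (nth v l i)) _ (p i)
  (@coordinate_continuous R V (nth v l i) y)).
Qed.

Lemma open_star_support (y : RV) : K y -> 0 < y v ->
  forall u, u != v -> u \notin l -> y u = 0.
Proof.
have [_ _ lh _] := lk.
move=> /realization_cliqueP[_ _ yh] yv u uv; rewrite lh; apply: contraNeq => yu.
by apply: yh => //; [rewrite eq_sym|rewrite gt_eqF].
Qed.

Lemma star_chart_image (y : RV) : K y -> 0 < y v -> star_image (star_chart y).
Proof.
move=> Ky yv; rewrite /star_image /=.
rewrite (eq_bigr (fun i : 'I_n => y (nth v l i))); last first.
  by move=> i _; rewrite tent_star_chart.
have /realization_cliqueP[_ <- _] := Ky.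
by rewrite (sum_star (open_star_support Ky yv)) ltrDr.
Qed.

(** The inverse chart. The weight left for [v] is positive exactly on [star_image]. *)
Definition star_param (z : 'rV[R]_2) : RV := fun u =>
  if u == v then 1 - \sum_(i < n) t i z
  else if u \in l then t (index u l) z else 0.

Lemma star_param_nth z i : (i < n)%N -> star_param z (nth v l i) = t i z.
Proof.
have [/= /andP[vl ul] _ _ _] := lk.
move=> ni; rewrite /star_param mem_nth // index_uniq // ifF //.
by apply: contraNF vl => /eqP <-; exact: mem_nth.
Qed.

Lemma star_param_in z : star_image z -> K (star_param z).
Proof.
have [/= /andP[vl ul] _ lh hl] := lk; have [_ conet _ _] := pt.
move=> Wz; have [t0 tadj] := conet z; apply/realization_cliqueP; split.
- move=> u; rewrite /star_param; case: ifP => _; first by rewrite subr_ge0 ltW.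
  by case: ifP.
- rewrite sum_star; last first.
    by move=> u /negbTE uv /negbTE ul'; rewrite /star_param uv ul'.
  rewrite {1}/star_param eqxx.
  rewrite [X in _ + X](eq_bigr (fun i : 'I_n => t i z)) ?subrK //.
  by move=> i _; rewrite star_param_nth.
- have supp u : u != v -> star_param z u != 0 -> u \in l.
    by rewrite /star_param => /negbTE->; case: ifP; rewrite ?eqxx.
  move=> a b ab za zb.
  have [av|av] := eqVneq a v; first by rewrite av -lh supp // -av eq_sym.
  have [bv|bv] := eqVneq b v; first by rewrite bv h_sym -lh supp.
  have al := supp _ av za; have bl := supp _ bv zb.
  wlog ij : a b ab za zb av bv al bl / (index a l < index b l)%N.
    move=> H; case: (ltngtP (index a l) (index b l)) => ij; first exact: H.
      by rewrite h_sym; apply: H => //; rewrite eq_sym.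
    by case/eqP: ab; rewrite -(nth_index v al) ij nth_index.
  have bn : (index b l < n)%N by rewrite index_mem.
  have an : (index a l < n)%N by rewrite index_mem.
  rewrite -(nth_index v al) -(nth_index v bl) hl ?ij //.
  apply/negPn/negP; rewrite negb_or => /andP[n1 n2].
  have [] := tadj (index a l) (index b l) _ n2; first by rewrite -/n; lia.
    by move=> h0; case/eqP: za; rewrite -(nth_index v al) star_param_nth.
  by move=> h0; case/eqP: zb; rewrite -(nth_index v bl) star_param_nth.
Qed.

Lemma star_param_gt0 z : star_image z -> 0 < star_param z v.
Proof. by move=> Wz; rewrite /star_param eqxx subr_gt0. Qed.

Lemma star_param_continuous : continuous star_param.
Proof.
have [ct _ _ _] := pt.
apply: continuous_pointwise => u; rewrite /star_param.
case: (u == v).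
  move=> z.
  exact: (cvgB (@cst_continuous _ _ (1 : R) z) (@tent_sum_continuous z)).
case: (u \in l); first exact: (ct (index u l)).
exact: cst_continuous.
Qed.

Lemma star_chartK (y : RV) : K y -> 0 < y v -> star_param (star_chart y) = y.
Proof.
move=> Ky yv; apply/funext => u; rewrite /star_param.
have y0 := open_star_support Ky yv.
case: eqVneq => [->|uv].
  rewrite (eq_bigr (fun i : 'I_n => y (nth v l i))); last first.
    by move=> i _; rewrite tent_star_chart.
  have /realization_cliqueP[_ <- _] := Ky.
  by rewrite (sum_star y0) addrK.
case: ifPn => ul; last by rewrite y0.
by rewrite tent_star_chart ?nth_index // index_mem.
Qed.

Lemma star_paramK z : star_chart (star_param z) = z.
Proof.
have [_ _ tK _] := pt; rewrite -[RHS]tK; apply: eq_bigr => i _.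
by rewrite star_param_nth.
Qed.

Lemma open_star_homeomorphic :
  homeomorphic (set_type open_star) (set_type star_image).
Proof.
have Kv (y : X) : K (\val y) by exact: set_valP.
have fP (y : set_type open_star) : star_image (star_chart (\val (\val y))).
  by apply: star_chart_image => //; exact: (set_valP y).
have gP (z : set_type star_image) : K (star_param (\val z)).
  by apply: star_param_in; exact: set_valP.
have gP' (z : set_type star_image) : open_star (to_set_type (gP z)).
  by apply: star_param_gt0; exact: set_valP.
pose f (y : set_type open_star) : set_type star_image :=
  to_set_type (fP y).
pose g (z : set_type star_image) : set_type open_star :=
  to_set_type (gP' z).
exists f, g; split.
- apply: continuous_set_type => y /=.
  apply: (@continuous_comp _ _ _ (fun y : set_type open_star => \val (\val y))).
    by apply: continuous_comp; exact: set_val_continuous.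
  exact: star_chart_continuous.
- apply: continuous_set_type; apply: continuous_set_type => z /=.
  apply: continuous_comp; first exact: set_val_continuous.
  exact: star_param_continuous.
- move=> y; apply: val_inj; apply: val_inj => /=; apply: star_chartK.
    exact: Kv.
  exact: (set_valP y).
- by move=> z; apply: val_inj => /=; exact: star_paramK.
Qed.

End Star.

(** Every point lies in the open star of each vertex of its support, and the fan with as many rays
    as the link has vertices gives a chart there. *)
Lemma realization_locally_euclidean :
  (forall v, exists l, link_cycle v l) -> locally_euclidean R 2 X.
Proof.
move=> links x.
have [x0 xS xh] := (realization_cliqueP _ _).1 (set_valP x).
have [v xv] := realization_support (set_valP x).
have [l lk] := links v.
have [_ n3 _ _] := lk.
have [p [t pt]] := fan_exists R n3.
exists (open_star v), (star_image l t); split.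
- split; first exact: open_star_open.
  by rewrite /open_star /= lt_neqAle eq_sym xv x0.
- exact: star_image_open pt.
- exact (open_star_homeomorphic lk pt).
Qed.

Lemma realization_closed_surface :
  (forall v, exists l, link_cycle v l) -> (forall a b, connect h a b) ->
  V -> closed_surface_triangulation R (clique_complex h).
Proof.
move=> links h_conn v0; have K0 := vertex_point_in R h v0.
split.
- split.
  + apply: set_type_hausdorff.
    exact: (@hausdorff_product V (fun=> R) (fun=> @Rhausdorff R)).
  + exact (@compact_subset_second_countable R RV K
      (@realization_compact R V h) (ex_intro _ (vertex_point R v0) K0)).
  + exact: realization_locally_euclidean.
- exact (set_type_compact (@realization_compact R V h)).
- exact (@realization_connected R V h h_sym h_conn).
- by exists (to_set_type K0).
Qed.

End Charts.

(** * Oriented triangles *)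

Section OrientedTriangles.
Local Set Implicit Arguments.
Local Unset Strict Implicit.
Variables (V : finType) (h : rel V) (pos : V -> V -> V -> bool).

(* [pos a b c] says that [a, b, c] are the vertices of a triangle in positive
   order, so that [pos v] is the successor relation on the link of [v]. *)
Definition oriented_surface : Prop :=
  [/\ forall a b c, pos a b c -> pos b c a,
      forall a b c d, pos a b c -> pos a b d -> c = d,
      forall a b, h a b <-> exists c, pos a b c,
      forall a b c, h a b -> h b c -> h a c -> pos a b c \/ pos a c b &
      forall v a b, h v a -> h v b -> connect (pos v) a b].

Hypotheses (h_sym : symmetric h) (h_irr : irreflexive h).
Hypothesis h_surf : oriented_surface.
Hypothesis h_deg : forall v, (3 < #|h v|)%N.

Let pos_rot a b c : pos a b c -> pos b c a.
Proof. by case: h_surf => H _ _ _ _; exact: H. Qed.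

Let pos_fun a b c d : pos a b c -> pos a b d -> c = d.
Proof. by case: h_surf => _ H _ _ _; exact: H. Qed.

Let pos_adj a b c : pos a b c -> [/\ h a b, h b c & h c a].
Proof.
have posh x y z : pos x y z -> h x y.
  by case: h_surf => _ _ H _ _ p; apply/H; exists z.
move=> p; split; first exact: posh p.
  exact: posh (pos_rot p).
exact: posh (pos_rot (pos_rot p)).
Qed.

(** The successor relation [pos v] is a function on the neighbors of [v], injective because triples
    can be rotated, and its orbit exhausts the neighbors by connectedness. A chord of this orbit
    would span a triangle with [v], and so join an element to its successor. *)
Lemma link_cycle_exists v : exists l, link_cycle h v l.
Proof.
have [_ _ hP tri conn] := h_surf.
have [a0 ha0] : exists a0, h v a0.
  have /card_gt0P[a ?] : (0 < #|h v|)%N by apply: leq_trans (h_deg v).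
  by exists a.
(* Fixing the vertices that are not adjacent to [v] makes [f] a permutation of all of [V]. *)
pose f a := odflt a [pick c | pos v a c].
have fE a c : pos v a c -> f a = c.
  move=> p; rewrite /f; case: pickP => [d /= q|/(_ c)]; last by rewrite p.
  exact: pos_fun q p.
have fP a : h v a -> pos v a (f a) by move=> /hP[c p]; rewrite (fE _ _ p).
have fN a : ~~ h v a -> f a = a.
  move=> na; rewrite /f; case: pickP => //= c /pos_adj[].
  by rewrite (negbTE na).
have fh a : h v a -> h v (f a) by move=> /fP/pos_adj[_ _]; rewrite h_sym.
have f_inj : injective f.
  move=> a b ab; have [ha|na] := boolP (h v a); last first.
    have [hb|nb] := boolP (h v b); last by rewrite -(fN a) // ab fN.
    by have := na; rewrite -(fN a na) ab fh.
  have [hb|nb] := boolP (h v b); last by have := nb; rewrite -(fN b nb) -ab fh.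
  have := fP a ha; rewrite ab => /pos_rot/pos_rot p.
  exact: pos_fun p (pos_rot (pos_rot (fP b hb))).
pose l := orbit f a0.
have lh u : (u \in l) = h v u.
  rewrite -fconnect_orbit; apply/idP/idP.
    move=> /iter_findex <-; elim: (findex _ _ _) => // n IH; exact: fh.
  move=> hu; apply: connect_sub (conn v a0 u ha0 hu) => x y /= /fE <-.
  exact: fconnect1.
have sz : (3 < size l)%N.
  apply: leq_trans (h_deg v) _; rewrite -(card_uniqP (orbit_uniq f a0)).
  by apply: subset_leq_card; apply/fintype.subsetP => u; rewrite lh.
have nthE i : (i < size l)%N -> nth v l i = iter i f a0.
  move=> iz; rewrite (set_nth_default a0) // nth_traject //.
  by rewrite -size_orbit.
exists l; split=> //.
  by rewrite /= lh h_irr orbit_uniq.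
move=> i j /andP[ij jn].
have ni : (i < size l)%N by exact: ltn_trans jn.
have iter_inj i' j' : (i' < size l)%N -> (j' < size l)%N ->
    iter i' f a0 = iter j' f a0 -> i' = j'.
  move=> ? ? ?; apply/eqP.
  by rewrite -(nth_uniq v _ _ (orbit_uniq f a0)) ?nthE //; apply/eqP.
have hi k : h v (iter k f a0) by elim: k => // k IH; exact: fh.
have iter_size : iter (size l) f a0 = a0 by rewrite size_orbit iter_order.
rewrite !nthE //; apply/idP/orP.
  move=> hij; have [/fE e|/fE e] := tri _ _ _ (hi i) hij (hi j).
    by left; apply/eqP; apply: iter_inj => //; exact: leq_ltn_trans jn.
  (* Here the successor of the entry at [j] is the entry at [i] < [j], which forces [j] to be the
     last index and [i] to be 0. *)
  right; have [jn'|] := ltnP j.+1 (size l).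
    have : j.+1 = i by apply: iter_inj.
    by move=> ji; move: ij; rewrite -ji ltnNge leqnSn.
  move=> nj; have jE : j.+1 = size l by apply/eqP; rewrite eqn_leq jn.
  rewrite jE eqxx andbT; apply/eqP; apply: iter_inj => //.
    exact: leq_trans sz.
  by rewrite -e -[f _]/(iter j.+1 f a0) jE iter_size.
move=> [/eqP->|/andP[/eqP-> /eqP jE]].
  by have [_ + _] := pos_adj (fP _ (hi i)).
have [_ + _] := pos_adj (fP _ (hi j)).
by rewrite -[f _]/(iter j.+1 f a0) jE iter_size h_sym.
Qed.

(** If both orders were positive, the successor relation at [a] would exchange [b] and [c]. By
    connectedness [a] would have no other neighbors, against its degree. *)
Lemma pos_asym a b c : pos a b c -> ~~ pos b a c.
Proof.
have [_ _ _ _ conn] := h_surf.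
move=> p; apply/negP => /pos_rot q.
have [hab _ _] := pos_adj p.
suff sub : h a \subset [:: b; c].
  have := leq_trans (h_deg a) (leq_trans (subset_leq_card sub) (card_size _)).
  by [].
apply/fintype.subsetP => u hau; have /connectP[s sP ->] := conn a b u hab hau.
suff stay x : x \in [:: b; c] -> path (pos a) x s -> last x s \in [:: b; c].
  by apply: stay => //; rewrite inE eqxx.
elim: s x {sP} => //= y s IH x xbc /andP[xy]; apply: IH.
move: xbc xy; rewrite !inE => /orP[]/eqP-> xy.
  by rewrite (pos_fun xy p) eqxx orbT.
by rewrite (pos_fun xy q) eqxx.
Qed.

(** The orientation is [pos] itself: an oriented edge has a single positive triangle, so two
    triangles on a common edge induce opposite directions on it. *)
Lemma clique_complex_orientable : orientable (clique_complex h).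
Proof.
have [_ _ _ tri _] := h_surf.
exists pos; split.
- move=> a b c _; apply/idP/idP; last exact: pos_rot.
  by move=> /pos_rot/pos_rot.
- move=> a b c /clique_complex_triangle[hab hbc hac].
  apply/idP/idP; first by move=> /pos_asym.
  by case: (tri _ _ _ hab hbc hac) => [->//|/pos_rot/pos_rot].
- move=> a b c d /clique_complex_triangle[hab hbc hac].
  move=> /clique_complex_triangle[_ hbd had] cd.
  have [p|p] := tri _ _ _ hab hbc hac; have [q|q] := tri _ _ _ hab hbd had.
  + by case/eqP: cd; exact: pos_fun p q.
  + rewrite p; apply/negbTE/pos_asym; exact: (pos_rot (pos_rot q)).
  + rewrite q; apply/esym/(contraNN _ (pos_asym q)) => p'.
    by case/eqP: cd; exact: pos_fun p' q.
  + case/eqP: cd; exact: pos_fun (pos_rot (pos_rot p)) (pos_rot (pos_rot q)).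
Qed.

End OrientedTriangles.

(** * Filling the faces of a ribbon graph *)

Section FaceVertex.
Local Set Implicit Arguments.
Local Unset Strict Implicit.

(* Each face of the ribbon graph is filled by two concentric rings [VU] and [VW]
   of vertices, with one vertex for each dart of the face, around a central
   vertex [VC]. *)
Inductive face_vertex (X D C : Type) :=
  | VX of X | VU of D | VW of D | VC of C.

Definition face_vertex_code X D C (a : face_vertex X D C) : X + D + (D + C) :=
  match a with
  | VX x => inl (inl x) | VU d => inl (inr d)
  | VW d => inr (inl d) | VC c => inr (inr c)
  end.

Definition face_vertex_decode X D C (a : X + D + (D + C)) : face_vertex X D C :=
  match a with
  | inl (inl x) => VX D C x | inl (inr d) => VU X C d
  | inr (inl d) => VW X C d | inr (inr c) => VC X D c
  end.

Lemma face_vertex_codeK X D C :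
  cancel (@face_vertex_code X D C) (@face_vertex_decode X D C).
Proof. by case. Qed.

End FaceVertex.

Arguments VX {X D C}.
Arguments VU {X D C}.
Arguments VW {X D C}.
Arguments VC {X D C}.

HB.instance Definition _ (X D C : finType) :=
  Finite.copy (face_vertex X D C) (can_type (@face_vertex_codeK X D C)).

Section Filling.
Local Set Implicit Arguments.
Local Unset Strict Implicit.
Variables (X D C : finType) (e : rel X) (src tgt : D -> X) (rev phi : D -> D).
Variable (face : D -> C).

Hypotheses (e_sym : symmetric e) (e_irr : irreflexive e).
Hypothesis e3 : forall x y z, e x y -> e y z -> e x z -> False.
Hypothesis e4 : forall x y z w, e x y -> e y z -> e z w -> e w x ->
  x != z -> y = w.
Hypothesis e_conn : forall x y, connect e x y.
Hypothesis dart_edge : forall d, e (src d) (tgt d).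
Hypothesis dart_inj : forall d d', src d = src d' -> tgt d = tgt d' -> d = d'.
Hypothesis dart_exists : forall x y, e x y -> exists d, src d = x /\ tgt d = y.
Hypotheses (src_rev : forall d, src (rev d) = tgt d)
           (tgt_rev : forall d, tgt (rev d) = src d).
Hypothesis phi_inj : injective phi.
Hypothesis src_phi : forall d, src (phi d) = tgt d.
Hypothesis tgt_phi : forall d, tgt (phi d) <> src d.
Hypothesis rotation_transitive : forall d d', src d = src d' ->
  fconnect (fun d => phi (rev d)) d d'.
Hypothesis deg2 : forall x, exists d d', [/\ src d = x, src d' = x & d <> d'].
Hypothesis face_phi : forall d, face (phi d) = face d.
Hypothesis faceP : forall d d', face d = face d' -> fconnect phi d d'.
Hypothesis face_surj : forall c, exists d, face d = c.

Local Notation vertex := (face_vertex X D C).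

(** The hypotheses describe a ribbon graph: [phi] follows the faces, [phi] after [rev] rotates the
    darts about their source, and [tgt_phi] forbids backtracking. The vertex [VU d] sits over the
    side [d] of a face and [VW d] over the side from [VU d] to [VU (phi d)], so that both annuli are
    triangulated as antiprisms. *)
Definition adj (a b : vertex) : bool :=
  match a, b with
  | VX x, VX y => e x y
  | VX x, VU d | VU d, VX x => (x == src d) || (x == tgt d)
  | VU d, VU d' | VW d, VW d' => (d' == phi d) || (d == phi d')
  | VU d, VW d' | VW d', VU d => (d == d') || (d == phi d')
  | VW d, VC c | VC c, VW d => c == face d
  | _, _ => false
  end.

(* Up to rotation, the positive triangles are (src d, tgt d, u_d),
   (u_d, tgt d, u_(phi d)), (u_d, u_(phi d), w_d), (w_d, u_(phi d), w_(phi d))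
   and (w_d, w_(phi d), face d), where [phi d] is the dart that follows [d] on
   the boundary of the face to its left. *)
Definition pos (a b c : vertex) : bool :=
  match a, b, c with
  | VX x, VX y, VU d | VX y, VU d, VX x | VU d, VX x, VX y =>
      (x == src d) && (y == tgt d)
  | VU d, VX x, VU d' | VX x, VU d', VU d | VU d', VU d, VX x =>
      (x == tgt d) && (d' == phi d)
  | VU d, VU d', VW f | VU d', VW f, VU d | VW f, VU d, VU d' =>
      (d' == phi d) && (f == d)
  | VW f, VU d, VW f' | VU d, VW f', VW f | VW f', VW f, VU d =>
      (d == phi f) && (f' == phi f)
  | VW f, VW f', VC c | VW f', VC c, VW f | VC c, VW f, VW f' =>
      (f' == phi f) && (c == face f)
  | _, _, _ => false
  end.

Lemma src_neq_tgt d : src d <> tgt d.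
Proof. by move=> E; have := dart_edge d; rewrite E e_irr. Qed.

(** With [phi2], [phi3] and [phi4], this shows that facial walks have length at least 5: a shorter
    one would give a loop, a backtrack, a 3-cycle or a 4-cycle. *)
Lemma phi1 d : phi d <> d.
Proof. by move=> E; apply: (@src_neq_tgt d); rewrite -src_phi E. Qed.

Lemma phi2 d : phi (phi d) <> d.
Proof. by move=> E; apply: (@tgt_phi d); rewrite -src_phi E. Qed.

Lemma edge_phi d : e (tgt d) (tgt (phi d)).
Proof. by rewrite -{1}src_phi. Qed.

Lemma phi3 d : phi (phi (phi d)) <> d.
Proof.
move=> E; apply: (@e3 (src d) (tgt d) (tgt (phi d))) => //.
  exact: edge_phi.
by rewrite e_sym -{2}E src_phi edge_phi.
Qed.

Lemma phi4 d : phi (phi (phi (phi d))) <> d.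
Proof.
move=> E; apply: (@tgt_phi (phi d)).
rewrite src_phi; apply: (@e4 (tgt (phi d)) _ (src d)).
- exact: edge_phi.
- by rewrite -{2}E src_phi edge_phi.
- exact: dart_edge.
- exact: edge_phi.
- by apply/eqP; exact: tgt_phi.
Qed.

Lemma adj_sym : symmetric adj.
Proof.
by move=> [x|d|d|c] [y|d'|d'|c'] //=; rewrite orbC.
Qed.

Lemma adj_irr : irreflexive adj.
Proof.
move=> [x|d|d|c] //=; rewrite orbb eq_sym; apply/eqP; exact: phi1.
Qed.

Lemma pos_rot a b c : pos a b c -> pos b c a.
Proof. by case: a => ?; case: b => ?; case: c => ?. Qed.

(** Reduces adjacencies to equations between darts in normal form. It is iterated in [unpack]
    because each substitution can expose new terms to simplify. *)
Ltac unpack_once := repeat match goal with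
  | H : is_true (_ && _) |- _ => case/andP: H => ? ?
  | H : is_true (_ || _) |- _ => case/orP: H => ?
  | H : is_true (_ == _) |- _ => move/eqP: H => H
  | H : phi _ = phi _ |- _ => apply phi_inj in H
  | H : context [src (phi _)] |- _ => rewrite src_phi in H
  | H : context [face (phi _)] |- _ => rewrite face_phi in H
  end; try subst.

Ltac unpack := unpack_once; unpack_once; unpack_once.

Ltac contra_phi := match goal with
  | H : is_true false |- _ => by []
  | H : src ?d = tgt ?d |- _ => by case: (@src_neq_tgt d)
  | H : tgt ?d = src ?d |- _ => by case: (@src_neq_tgt d)
  | H : tgt (phi ?d) = src ?d |- _ => by case: (@tgt_phi d)
  | H : src ?d = tgt (phi ?d) |- _ => by case: (@tgt_phi d)
  | H : tgt (phi ?d) = tgt ?d |- _ =>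
      by case: (@src_neq_tgt (phi d)); rewrite src_phi
  | H : tgt ?d = tgt (phi ?d) |- _ =>
      by case: (@src_neq_tgt (phi d)); rewrite src_phi
  | H : phi ?d = ?d |- _ => by case: (@phi1 d)
  | H : ?d = phi ?d |- _ => by case: (@phi1 d)
  | H : phi (phi ?d) = ?d |- _ => by case: (@phi2 d)
  | H : ?d = phi (phi ?d) |- _ => by case: (@phi2 d)
  | H : phi (phi (phi ?d)) = ?d |- _ => by case: (@phi3 d)
  | H : ?d = phi (phi (phi ?d)) |- _ => by case: (@phi3 d)
  | H : phi (phi (phi (phi ?d))) = ?d |- _ => by case: (@phi4 d)
  | H : ?d = phi (phi (phi (phi ?d))) |- _ => by case: (@phi4 d)
  end.

Lemma pos_fun a b c d : pos a b c -> pos a b d -> c = d.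
Proof.
case: a => a; case: b => b; case: c => c //; case: d => d //= H1 H2; unpack;
  try contra_phi; try done.
(* What is left are two triangles on an edge of the graph, whose dart is determined by its ends. *)
all: by congr VU; apply: dart_inj.
Qed.

Lemma phi_finv d : phi (finv phi d) = d.
Proof. exact: f_finv. Qed.

Lemma adjP a b : adj a b <-> exists c, pos a b c.
Proof.
split=> [|[c]]; last first.
  case: a => a; case: b => b; case: c => c //= H; unpack;
    rewrite ?src_phi ?face_phi ?eqxx ?orbT //; exact: dart_edge.
case: a => a; case: b => b //= H.
- by have [d [<- <-]] := dart_exists H; exists (VU d); rewrite /= !eqxx.
- unpack; last by exists (VX (src b)); rewrite /= !eqxx.
  (* The dart [finv phi b] precedes [b] on its facial walk. *)
  by exists (VU (finv phi b)); rewrite /= -src_phi phi_finv !eqxx.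
- by unpack; [exists (VX (tgt a))|exists (VU (phi a))]; rewrite /= !eqxx.
- by unpack; [exists (VW a)|exists (VX (tgt b))]; rewrite /= !eqxx.
- unpack; last by exists (VU b); rewrite /= !eqxx.
  by exists (VW (finv phi b)); rewrite /= phi_finv !eqxx.
- by unpack; [exists (VU (phi a))|exists (VW (phi a))]; rewrite /= !eqxx.
- by unpack; [exists (VC (face a))|exists (VU (phi b))]; rewrite /= !eqxx.
- unpack; exists (VW (finv phi a)).
  by rewrite /= -(face_phi (finv phi a)) phi_finv !eqxx.
- by unpack; exists (VW (phi b)); rewrite /= !eqxx.
Qed.

(** By cases on the kinds of vertices: three pairwise adjacent vertices that are not one of the
    listed triangles would give a loop, a backtrack, a facial walk that is too short or a 3-cycle of
    the graph. *)
Lemma pos_triangle a b c : adj a b -> adj b c -> adj a c ->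
  pos a b c \/ pos a c b.
Proof.
case: a => a; case: b => b //; case: c => c //= H1 H2 H3; unpack;
  try contra_phi.
all: try match goal with
  | H : is_true (e ?x ?x) |- _ => by rewrite e_irr in H end.
all: try (by left; rewrite ?src_phi ?face_phi ?eqxx).
all: try (by right; rewrite ?src_phi ?face_phi ?eqxx).
by case: (e3 H1 H2 H3).
Qed.

(** Such an edge would close two consecutive sides of a face to a 3-cycle. *)
Lemma no_chord d : ~ e (src d) (tgt (phi d)).
Proof. exact: e3 (dart_edge d) (edge_phi d). Qed.

Lemma tgt_phi2 d : tgt (phi (phi d)) <> src d.
Proof.
move=> E; have := edge_phi (phi d); rewrite E e_sym; exact: no_chord.
Qed.

Lemma tgt_phi2' d : tgt (phi (phi d)) <> tgt d.
Proof. by rewrite -(src_phi d); exact: tgt_phi. Qed.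

Lemma edge_dart d : e (tgt d) (src d).
Proof. by rewrite e_sym. Qed.

Ltac contra_chord := match goal with
  | H : is_true (e (src ?d) (tgt (phi ?d))) |- _ => by case: (no_chord H)
  | H : is_true (e (tgt (phi ?d)) (src ?d)) |- _ =>
      by rewrite e_sym in H; case: (no_chord H)
  | H : tgt (phi (phi ?d)) = src ?d |- _ => by case: (tgt_phi2 H)
  | H : src ?d = tgt (phi (phi ?d)) |- _ => by case: (tgt_phi2 (esym H))
  | H : tgt (phi (phi ?d)) = tgt ?d |- _ => by case: (tgt_phi2' H)
  | H : is_true (~~ e (src ?d) (tgt ?d)) |- _ => by rewrite dart_edge in H
  | H : is_true (~~ e (tgt ?d) (src ?d)) |- _ => by rewrite edge_dart in H
  end.

Ltac contra_edge a := have := dart_edge a; have := edge_dart a; congruence.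

Lemma adj_no_square a b c d : a != c -> b != d ->
  adj a b -> adj b c -> adj c d -> adj d a -> adj a c || adj b d.
Proof.
move=> /eqP ac /eqP bd H1 H2 H3 H4; apply: contraT => /norP[].
case: a ac H1 H4 => a ac H1 H4; case: b bd H1 H2 => b bd H1 H2 //;
  case: c ac H2 H3 => c ac H2 H3 //; case: d bd H3 H4 => d bd H3 H4 //=.
all: simpl in H1, H2, H3, H4 => n1 n2; unpack; try contra_phi; try done.
all: try (by case: ac); try (by case: bd).
all: try (by rewrite ?eqxx ?orbT in n1); try (by rewrite ?eqxx ?orbT in n2).
all: try contra_chord; try congruence.
(* All four vertices belong to the graph, which has no 4-cycle. *)
- by case: bd; rewrite (e4 H1 H2 H3 H4) //; apply/eqP => E; rewrite E in ac.
all: move/negbTE: n1 => n1; move/negbTE: n2 => n2.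
(* Two distinct graph vertices joined to the same [VU] vertex are the ends of its dart, hence
   adjacent. *)
all: first [contra_edge b | contra_edge a].
Qed.

(** A graph vertex has two neighbors in the graph by [deg2], and a [VU] neighbor for each of the two
    darts. For the center of a face, four consecutive [VW] vertices are distinct by [phi1], [phi2]
    and [phi3]. *)
Lemma adj_degree a : 3 < #|adj a|.
Proof.
suff [s [us ss sa]] : exists s, [/\ uniq s, size s = 4 & {subset s <= adj a}].
  rewrite -[4]ss -(card_uniqP us).
  by apply: subset_leq_card; apply/fintype.subsetP.
case: a => [x|d|d|c].
- have [d [d' [sd sd' dd']]] := deg2 x.
  exists ([:: VX (tgt d); VX (tgt d'); VU d; VU d'] : seq vertex); split=> //.
    rewrite /= !inE !negb_or !andbT; apply/andP; split; apply/eqP => -[] E //.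
    by apply: dd'; apply: dart_inj; rewrite ?sd.
  move=> b; rewrite !inE => /or4P[]/eqP->; rewrite /in_mem /= ?sd ?sd' ?eqxx //.
    by rewrite -sd.
  by rewrite -sd'.
(* Writing the dart as [phi f] gives access to its predecessor [f] on the face. *)
- rewrite -(phi_finv d); move: (finv phi d) => f.
  exists ([:: VU (phi (phi f)); VU f; VW (phi f); VW f] : seq vertex).
  split=> //.
    rewrite /= !inE !negb_or !andbT.
    by apply/andP; split; apply/eqP => -[]; [exact: phi2|exact: phi1].
  by move=> b; rewrite !inE => /or4P[]/eqP->; rewrite /in_mem /= ?eqxx ?orbT.
- rewrite -(phi_finv d); move: (finv phi d) => f.
  exists ([:: VU (phi f); VU (phi (phi f)); VW (phi (phi f)); VW f]
    : seq vertex); split=> //.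
    rewrite /= !inE !negb_or !andbT.
    by apply/andP; split; apply/eqP => -[];
      [move/esym; exact: phi1|exact: phi2].
  by move=> b; rewrite !inE => /or4P[]/eqP->; rewrite /in_mem /= ?eqxx ?orbT.
- have [d <-] := face_surj c.
  exists ([:: VW d; VW (phi d); VW (phi (phi d)); VW (phi (phi (phi d)))]
    : seq vertex); split=> //.
    rewrite /= !inE !negb_or !andbT; apply/and3P; split.
    + by apply/and3P; split; apply/eqP => -[] /esym;
        [exact: phi1|exact: phi2|exact: phi3].
    + by apply/andP; split; apply/eqP => -[] /esym; [exact: phi1|exact: phi2].
    + by apply/eqP => -[] /esym; exact: phi1.
  move=> b; rewrite !inE => /or4P[]/eqP->.
  all: by rewrite /in_mem /= ?face_phi ?eqxx.
Qed.

Lemma link_transitive_VU d a b : adj (VU d) a -> adj (VU d) b ->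
  connect (pos (VU d)) a b.
Proof.
rewrite -(phi_finv d); move: (finv phi d) => f.
pose p : seq vertex := [:: VX (src (phi f)); VX (tgt (phi f)); VU (phi (phi f));
  VW (phi f); VW f; VU f].
have cp : cycle (pos (VU (phi f))) p.
  by rewrite /p /= !src_phi !eqxx.
have sub c : adj (VU (phi f)) c -> c \in p.
  by case: c => c //= H; rewrite /p !inE; unpack; rewrite ?src_phi ?eqxx ?orbT.
by move=> /sub ha /sub hb; exact: connect_cycle cp _ _ ha hb.
Qed.

Lemma link_transitive_VW d a b : adj (VW d) a -> adj (VW d) b ->
  connect (pos (VW d)) a b.
Proof.
rewrite -(phi_finv d); move: (finv phi d) => f.
pose p : seq vertex := [:: VU (phi f); VU (phi (phi f)); VW (phi (phi f));
  VC (face f); VW f].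
have cp : cycle (pos (VW (phi f))) p.
  by rewrite /p /= ?face_phi !eqxx.
have sub c : adj (VW (phi f)) c -> c \in p.
  by case: c => c //= H; rewrite /p !inE; unpack; rewrite ?src_phi ?eqxx ?orbT.
by move=> /sub ha /sub hb; exact: connect_cycle cp _ _ ha hb.
Qed.

Lemma link_transitive_VC c a b : adj (VC c) a -> adj (VC c) b ->
  connect (pos (VC c)) a b.
Proof.
case: a => // d; case: b => // d' /= /eqP-> /eqP E.
have /iter_findex <- := faceP E.
elim: (findex _ _ _) => //= n IH; apply: connect_trans IH (connect1 _).
rewrite /= eqxx /=; apply/eqP; by elim: n => //= n ->; rewrite face_phi.
Qed.

(** The corner between [phi (rev d)] and [d] at their common source is crossed through
    [VU (phi (rev d))] and [VU (rev d)]. The link thus runs against the rotation [phi] after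
    [rev]. *)
Lemma link_rotation d :
  connect (pos (VX (src d))) (VX (tgt (phi (rev d)))) (VX (tgt d)).
Proof.
apply: connect_trans (connect1 (_ : pos _ _ (VU (phi (rev d))))) _.
  by rewrite /= src_phi tgt_rev !eqxx.
apply: connect_trans (connect1 (_ : pos _ _ (VU (rev d)))) (connect1 _).
  by rewrite /= tgt_rev !eqxx.
by rewrite /= src_rev tgt_rev !eqxx.
Qed.

Lemma link_rotation_iter d n :
  connect (pos (VX (src d)))
    (VX (tgt (iter n (fun d => phi (rev d)) d))) (VX (tgt d)).
Proof.
elim: n => //= n; apply: connect_trans.
rewrite [src d](_ : _ = src (iter n (fun d => phi (rev d)) d)).
  exact: link_rotation.
by elim: n => //= n IH; rewrite src_phi tgt_rev.
Qed.

(** In the link of [x], every vertex leads to a graph neighbor of [x] and is reached from one;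
    between graph neighbors the path turns corner by corner. *)
Lemma link_transitive_VX x a b : adj (VX x) a -> adj (VX x) b ->
  connect (pos (VX x)) a b.
Proof.
have to_nbr c : adj (VX x) c ->
    exists2 d, src d = x & connect (pos (VX x)) c (VX (tgt d)).
  case: c => [y|d|//|//] /= H.
    by have [d [sd td]] := dart_exists H; exists d => //; rewrite td.
  have [d' td'] : exists d', tgt d' = x /\ connect (pos (VX x)) (VU d) (VU d').
    move: H => /orP[]/eqP->; last by exists d.
    exists (finv phi d); rewrite -src_phi phi_finv; split=> //.
    by apply: connect1; rewrite /= -{1}[d]phi_finv src_phi phi_finv !eqxx.
  case: td' => <- cd; exists (rev d'); first exact: src_rev.
  by apply: connect_trans cd (connect1 _); rewrite /= tgt_rev !eqxx.
have of_nbr c : adj (VX x) c ->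
    exists2 d, src d = x & connect (pos (VX x)) (VX (tgt d)) c.
  case: c => [y|d|//|//] /= H.
    by have [d [sd td]] := dart_exists H; exists d => //; rewrite td.
  move: H => /orP[]/eqP->.
    by exists d => //; apply: connect1; rewrite /= !eqxx.
  exists (phi d) => //.
  apply: connect_trans (connect1 (_ : pos _ _ (VU (phi d)))) (connect1 _).
    by rewrite /= src_phi !eqxx.
  by rewrite /= !eqxx.
move=> /to_nbr[d sd ad] /of_nbr[d' sd' bd'].
apply: connect_trans ad _; apply: connect_trans bd'.
(* As the link runs against the rotation, the latter is iterated from [d'] to [d]. *)
have : src d' = src d by rewrite sd.
move=> /rotation_transitive/iter_findex <-; rewrite -sd'.
exact: link_rotation_iter.
Qed.

Lemma link_transitive v a b : adj v a -> adj v b -> connect (pos v) a b.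
Proof.
case: v => [x|d|d|c].
- exact: link_transitive_VX.
- exact: link_transitive_VU.
- exact: link_transitive_VW.
- exact: link_transitive_VC.
Qed.

Lemma adj_connected a b : connect adj a b.
Proof.
have csym := sym_connect_sym adj_sym.
have base c : exists x, connect adj (VX x) c.
  case: c => [x|d|d|c]; first by exists x.
  - by exists (src d); apply: connect1; rewrite /= eqxx.
  - exists (src d).
    apply: connect_trans (connect1 (_ : adj _ (VU d))) (connect1 _).
      by rewrite /= eqxx.
    by rewrite /= eqxx.
  - have [d <-] := face_surj c; exists (src d).
    apply: connect_trans (connect1 (_ : adj _ (VU d))) _.
      by rewrite /= eqxx.
    apply: connect_trans (connect1 (_ : adj _ (VW d))) (connect1 _).
      by rewrite /= eqxx.
    by rewrite /= eqxx.
have [x xa] := base a; have [y yb] := base b.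
apply: connect_trans yb; rewrite csym; apply: connect_trans xa.
have /connectP[p + ->] := e_conn y x.
elim: p y => //= z p IH y /andP[yz /IH]; apply: connect_trans.
exact: connect1.
Qed.

End Filling.

(** * Ribbon graphs from graphs *)

Section DartsOfGraph.
Local Set Implicit Arguments.
Local Unset Strict Implicit.
Variables (X : finType) (e : rel X).
Hypotheses (e_sym : symmetric e) (e_irr : irreflexive e).
Hypothesis deg2 : forall x, exists y z, [/\ e x y, e x z & y <> z].

Definition dart := {p : X * X | e p.1 p.2}.
Definition dart_src (d : dart) : X := (val d).1.
Definition dart_tgt (d : dart) : X := (val d).2.
Definition Dart x y (xy : e x y) : dart := exist _ (x, y) xy.

Lemma dart_edge d : e (dart_src d) (dart_tgt d).
Proof. exact: (valP d). Qed.

Lemma dart_inj d d' :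
  dart_src d = dart_src d' -> dart_tgt d = dart_tgt d' -> d = d'.
Proof. by move=> s t; apply: val_inj; apply/eqP/andP; split; apply/eqP. Qed.

Lemma dart_rev_edge d : e (dart_tgt d) (dart_src d).
Proof. by rewrite e_sym; exact: dart_edge. Qed.

Definition dart_rev d : dart := Dart (dart_rev_edge d).

(* Any cyclic order of the neighbors does: it makes [e] a ribbon graph. *)
Definition next_neighbor x y := next (enum (e x)) y.

Lemma next_neighbor_edge x y : e x y -> e x (next_neighbor x y).
Proof. by rewrite -[e x y]mem_enum -[e x _]mem_enum mem_next. Qed.

Lemma next_neighbor_inj x : injective (next_neighbor x).
Proof. exact: can_inj (prev_next (enum_uniq _)). Qed.

Lemma next_neighbor_connect x y z : e x y -> e x z ->
  fconnect (next_neighbor x) y z.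
Proof.
move=> xy xz; rewrite (fconnect_cycle (cycle_next (enum_uniq (e x)))).
  by rewrite mem_enum.
by rewrite mem_enum.
Qed.

(** A fixed neighbor would be the only one, against [deg2]. This is what keeps facial walks from
    backtracking. *)
Lemma next_neighbor_neq x y : e x y -> next_neighbor x y <> y.
Proof.
move=> xy fixy; have stay z : e x z -> z = y.
  move=> xz; have /iter_findex <- := next_neighbor_connect xy xz.
  by elim: (findex _ _ _) => //= n ->.
by have [z [w [/stay-> /stay->]]] := deg2 x.
Qed.

Definition dart_phi d : dart := Dart (next_neighbor_edge (dart_rev_edge d)).

Lemma dart_phi_inj : injective dart_phi.
Proof.
move=> d d' E; have Et : dart_tgt d = dart_tgt d'.
  exact: (congr1 dart_src E).
apply: dart_inj => //; apply: (@next_neighbor_inj (dart_tgt d)).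
have := congr1 dart_tgt E.
by rewrite /dart_tgt /= -/(dart_tgt _) -/(dart_tgt _) -Et.
Qed.

(** Reversing a dart and then following its face keeps the source and moves the target to the next
    neighbor, and the neighbors form a single cycle. *)
Lemma dart_rotation_transitive d d' : dart_src d = dart_src d' ->
  fconnect (fun d => dart_phi (dart_rev d)) d d'.
Proof.
move=> ss; have hd := dart_edge d.
have hd' : e (dart_src d) (dart_tgt d') by rewrite ss; exact: dart_edge.
have it n : let c := iter n (fun d => dart_phi (dart_rev d)) d in
    dart_src c = dart_src d /\
    dart_tgt c = iter n (next_neighbor (dart_src d)) (dart_tgt d).
  elim: n => //= n [s t]; split=> //.
  by rewrite -t -[in RHS]s.
have <- : iter (findex (next_neighbor (dart_src d)) (dart_tgt d) (dart_tgt d'))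
    (fun d => dart_phi (dart_rev d)) d = d'.
  set n := findex _ _ _; have [s t] := it n.
  by apply: dart_inj; rewrite ?s ?t // iter_findex // next_neighbor_connect.
exact: fconnect_iter.
Qed.

(** Faces are the orbits of [dart_phi], each represented by its canonical root. *)
Definition dart_face := {d : dart | froots dart_phi d}.

Let phi_sym := fconnect_sym dart_phi_inj.

Definition face_of (d : dart) : dart_face :=
  exist _ (froot dart_phi d) (roots_root phi_sym d).

Lemma face_of_eq d d' : face_of d = face_of d' <-> fconnect dart_phi d d'.
Proof.
split=> [/(congr1 val)/eqP|]; first by rewrite /= (root_connect phi_sym).
by move=> c; apply/val_inj/eqP; rewrite /= (root_connect phi_sym).
Qed.

Lemma face_of_surj c : exists d, face_of d = c.
Proof. by exists (val c); apply/val_inj/eqP; exact: (valP c). Qed.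

End DartsOfGraph.

(** * Extension to a connected graph of minimum degree at least 2 *)

Section GraphExtension.
Local Set Implicit Arguments.
Local Unset Strict Implicit.
Variables (T : finType) (e : rel T).
Hypotheses (e_sym : symmetric e) (e_irr : irreflexive e).
Hypothesis e3 : forall x y z, e x y -> e y z -> e x z -> False.
Hypothesis e4 : forall x y z w, e x y -> e y z -> e z w -> e w x ->
  x != z -> y = w.

(** The two additional vertices provide each hub with two neighbors even when [T] is empty. *)
Let core := (T + bool)%type.

Definition core_adj (x y : core) : bool :=
  match x, y with inl u, inl v => e u v | _, _ => false end.

(* The graph [e] with two new isolated vertices, each vertex of which is then
   joined to two hubs by paths of length 2: this makes the graph connected, with
   no vertex of degree less than 2, and creates no cycle of length 3 or 4. *)
Definition hub_graph := (core + core * bool + bool)%type.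

Definition hub_adj (a b : hub_graph) : bool :=
  match a, b with
  | inl (inl x), inl (inl y) => core_adj x y
  | inl (inl x), inl (inr (y, _)) | inl (inr (y, _)), inl (inl x) => x == y
  | inl (inr (_, i)), inr j | inr j, inl (inr (_, i)) => i == j
  | _, _ => false
  end.

Lemma hub_adj_sym : symmetric hub_adj.
Proof.
by move=> [[[x|x]|[x i]]|i] [[[y|y]|[y j]]|j] //=.
Qed.

Lemma hub_adj_irr : irreflexive hub_adj.
Proof. by move=> [[[x|x]|[x i]]|i] //=. Qed.

Lemma core_adj3 x y z : core_adj x y -> core_adj y z -> core_adj x z -> False.
Proof. by case: x => x //; case: y => y //; case: z => z //; exact: e3. Qed.

Lemma core_adj4 x y z w : core_adj x y -> core_adj y z -> core_adj z w ->
  core_adj w x -> x != z -> y = w.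
Proof.
case: x => x //; case: y => y //; case: z => z //; case: w => w //= *.
by congr inl; apply: (@e4 x y z w).
Qed.

Lemma core_adj_irr x : core_adj x x = false.
Proof. by case: x => x /=. Qed.

Ltac eq_subst := repeat match goal with
  | H : is_true (_ == _) |- _ => move/eqP: H => H
  end; subst.

Lemma hub_adj3 a b c : hub_adj a b -> hub_adj b c -> hub_adj a c -> False.
Proof.
case: a => [[x|[x i]]|i]; case: b => [[y|[y j]]|j] //;
  case: c => [[z|[z k]]|k] //=; try exact: core_adj3.
all: move=> H1 H2 H3; eq_subst; try done.
all: by match goal with
  | H : is_true (core_adj ?x ?x) |- _ => rewrite core_adj_irr in H end.
Qed.

(** The midpoint of a spoke is adjacent only to its core vertex and its hub, and is their only
    common neighbor, so no 4-cycle passes through it. A 4-cycle would therefore lie in the core. *)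
Lemma hub_adj4 a b c d : hub_adj a b -> hub_adj b c -> hub_adj c d ->
  hub_adj d a -> a != c -> b = d.
Proof.
case: a => [[x|[x i]]|i]; case: b => [[y|[y j]]|j] //;
  case: c => [[z|[z k]]|k] //; case: d => [[w|[w l]]|l] //=.
all: move=> H1 H2 H3 H4 /eqP ac.
all: try (by congr (inl (inl _)); apply: core_adj4 H1 H2 H3 H4 _;
  apply/eqP => E; case: ac; rewrite E).
all: eq_subst; try done.

Qed.

Lemma hub_adj_deg2 a : exists b c, [/\ hub_adj a b, hub_adj a c & b <> c].
Proof.
case: a => [[x|[x i]]|i].
- by exists (inl (inr (x, true))), (inl (inr (x, false))); rewrite /= eqxx.
- by exists (inl (inl x)), (inr i); rewrite /= !eqxx.
- exists (inl (inr (inr true, i))), (inl (inr (inr false, i))).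
  by rewrite /= !eqxx.
Qed.

Lemma hub_adj_connected a b : connect hub_adj a b.
Proof.
have csym := sym_connect_sym hub_adj_sym.
pose hub : hub_graph := inr true.
have spoke x i : hub_adj (inl (inl x)) (inl (inr (x, i))) by rewrite /= eqxx.
have core_hub x i : connect hub_adj (inl (inl x)) (inr i).
  apply: connect_trans (connect1 (spoke x i)) (connect1 _); by rewrite /= eqxx.
have to_hub c : connect hub_adj c hub.
  case: c => [[x|[x i]]|i]; first exact: core_hub.
    by apply: connect_trans (core_hub x true); rewrite csym; exact: connect1.
  (* The hubs are joined to each other through the core vertex [inr true]. *)
  apply: connect_trans (core_hub (inr true) true); rewrite csym.
  exact: core_hub.
by apply: connect_trans (to_hub a) _; rewrite csym.
Qed.

End GraphExtension.

(** * Short cycles and the resulting surface *)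

Lemma girth5_no_triangle (T : finType) (e : rel T) (x y z : T) :
  simple_graph e -> girth_at_least e 5 -> e x y -> e y z -> e x z -> False.
Proof.
move=> [e_sym e_irr] e_girth xy yz xz.
have neq u v : e u v -> u != v.
  by move=> uv; apply: contraTneq uv => ->; rewrite e_irr.
have := e_girth [:: x; y; z].
rewrite /graph_cycle /ucycleb /= xy yz (e_sym z) xz.
by rewrite !inE negb_or (neq x y) // (neq x z) // (neq y z) // => /(_ isT).
Qed.

Lemma girth5_no_square (T : finType) (e : rel T) (x y z w : T) :
  simple_graph e -> girth_at_least e 5 ->
  e x y -> e y z -> e z w -> e w x -> x != z -> y = w.
Proof.
move=> [e_sym e_irr] e_girth xy yz zw wx xz; apply/eqP/negPn/negP => yw.
have neq u v : e u v -> u != v.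
  by move=> uv; apply: contraTneq uv => ->; rewrite e_irr.
have := e_girth [:: x; y; z; w].
rewrite /graph_cycle /ucycleb /= xy yz zw wx !inE !negb_or xz yw.
rewrite (neq x y) // (eq_sym x w) !(neq _ _ wx, neq _ _ yz, neq _ _ zw).
by move=> /(_ isT).
Qed.

(** The ordered edges and the cyclic orders of the neighbors make [e] a ribbon graph, and the
    surface is the clique complex of its filling. The vertex [x0] makes it nonempty. *)
Lemma girth5_surface (R : realType) (X : finType) (e : rel X) (x0 : X) :
  symmetric e -> irreflexive e ->
  (forall x y z, e x y -> e y z -> e x z -> False) ->
  (forall x y z w, e x y -> e y z -> e z w -> e w x -> x != z -> y = w) ->
  (forall x, exists y z, [/\ e x y, e x z & y <> z]) ->
  (forall x y, connect e x y) ->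
  exists (V : finType) (L : scomplex V),
    [/\ flag_no_square L, closed_surface_triangulation R L, orientable L &
        exists f : X -> V, induced_embedding e (skel1 L) f].
Proof.
move=> e_sym e_irr e3 e4 deg2 e_conn.
pose src := @dart_src X e; pose tgt := @dart_tgt X e.
pose phi := @dart_phi X e e_sym; pose rev := @dart_rev X e e_sym.
pose face := face_of e_sym.
have edge d : e (src d) (tgt d) := dart_edge d.
have dinj d d' : src d = src d' -> tgt d = tgt d' -> d = d'.
  exact: dart_inj.
have dex x y : e x y -> exists d, src d = x /\ tgt d = y.
  by move=> xy; exists (Dart xy).
have phiI : injective phi by exact: dart_phi_inj.
have sphi d : src (phi d) = tgt d by [].
have tphi d : tgt (phi d) <> src d.
  exact: (next_neighbor_neq deg2 (dart_rev_edge e_sym d)).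
have rot d d' : src d = src d' -> fconnect (fun d => phi (rev d)) d d'.
  exact: dart_rotation_transitive.
have deg x : exists d d', [/\ src d = x, src d' = x & d <> d'].
  have [y [z [xy xz yz]]] := deg2 x; exists (Dart xy), (Dart xz); split=> //.
  by move=> E; apply: yz; exact: (congr1 tgt E).
have facephi d : face (phi d) = face d.
  apply/face_of_eq; rewrite (fconnect_sym phiI); exact: fconnect1.
have faceE d d' : face d = face d' -> fconnect phi d d' by move/face_of_eq.
have facesurj c : exists d, face d = c by exact: face_of_surj.
pose h := adj e src tgt phi face.
have h_sym : symmetric h by exact: adj_sym.
have h_irr : irreflexive h by exact: adj_irr.
have h_surf : oriented_surface h (pos src tgt phi face).
  split.
  - by move=> a b c; exact: pos_rot.
  - exact: (pos_fun e_irr edge dinj phiI sphi tphi).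
  - exact: (adjP edge dex phiI sphi facephi).
  - exact: (pos_triangle e_sym e_irr e3 edge phiI sphi tphi facephi).
  - exact: (link_transitive dex _ _ phiI sphi rot facephi faceE).
have h_deg v : (3 < #|h v|)%N.
  exact: (adj_degree e_sym e_irr e3 edge dinj phiI sphi tphi deg
    facephi facesurj).
exists (face_vertex X (dart e) (dart_face e_sym)), (clique_complex h); split.
- apply: clique_complex_flag_no_square => // a b c d.
  exact: (adj_no_square e_sym e_irr e3 e4 edge phiI sphi tphi facephi).
- apply: realization_closed_surface => //.
  + by move=> v; exact: link_cycle_exists h_surf h_deg v.
  + exact: (adj_connected src tgt phi e_sym e_conn facesurj).
  + exact: VX x0.
- exact: clique_complex_orientable h_surf h_deg.
- exists VX; split=> [x y []//|x y].
  by rewrite skel1_clique_complex.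
Qed.

Theorem lemma5p3 (R : realType) (T : finType) (e : rel T)
    (e_simple : simple_graph e) (e_girth : girth_at_least e 5) :
  exists (V : finType) (L : scomplex V),
    [/\ flag_no_square L,
        closed_surface_triangulation R L,
        orientable L &
        exists f : T -> V, induced_embedding e (skel1 L) f].
Proof.
have [e_sym e_irr] := e_simple.
have e3 := fun x y z => @girth5_no_triangle T e x y z e_simple e_girth.
have e4 := fun x y z w => @girth5_no_square T e x y z w e_simple e_girth.
(* The hub [inr true] is a vertex of the extended graph even when [T] is empty. *)
have [V [L [Lflag Lsurf Lor [f [f_inj fh]]]]] :=
  @girth5_surface R (hub_graph T) (hub_adj e) (inr true) (hub_adj_sym e_sym)
    (hub_adj_irr e_irr) (hub_adj3 e_irr e3) (hub_adj4 e4) (@hub_adj_deg2 T e)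
    (hub_adj_connected e_sym).
(* The graph is induced in the core, the core in the extended graph, and the latter in the
   1-skeleton. *)
exists V, L; split=> //; exists (fun x => f (inl (inl (inl x)))); split.
  by move=> x y /f_inj[].
by move=> x y; rewrite fh.
Qed.
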